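(* Let $\mathrm{PoF}_n$ denote the price of MMS with respect to utilitarian welfare for allocating contiguous blocks of chores to $n$ agents. Then $\mathrm{PoF}_n=\Theta(n)$; that is, there are absolute constants $c,C>0$ such that $c\,n\le\mathrm{PoF}_n\le C n$ for every integer $n\ge 2$.
   Context: A fair-chores instance $\mathcal I=\langle N,E,\mathcal V\rangle$ consists of agents $N=\{1,\dots,n\}$, indivisible items $E=\{e_1,\dots,e_m\}$ placed on a path in this order, and for each agent $i$ an additive valuation $v_i$ (i.e. $v_i(S)=\sum_{e\in S}v_i(e)$) with $v_i(e)\le 0$ for all $e\in E$, normalized so that $v_i(\emptyset)=0$, $v_i(E)=-1$. A bundle is connected if it is a set of consecutive items (the empty set is allowed). An allocation $\mathbf A=(A_1,\dots,A_n)$ is a partition of $E$ into $n$ pairwise disjoint connected (possibly empty) bundles, $A_i$ being given to agent $i$ (the left-to-right order of the agents' bundles is arbitrary). Its utilitarian welfare is $\mathsf{UW}(\mathbf A)=\sum_{i\in N}v_i(A_i)$; $\mathsf{OPT}_U(\mathcal I)$ is the maximum of $\mathsf{UW}$ over all allocations of $\mathcal I$. The maximin share of agent $i$ is $\mathsf{MMS}_i(\mathcal I)=\max_{\mathbf X}\min_{j\in[n]}v_i(X_j)$, the maximum over all partitions $\mathbf X=(X_1,\dots,X_n)$ of $E$ into $n$ connected (possibly empty) bundles. An allocation $\mathbf A$ is MMS fair if $v_i(A_i)\ge \mathsf{MMS}_i(\mathcal I)$ for all $i\in N$. The price of fairness is $\mathrm{PoF}_n=\sup_{\mathcal I}\min_{\mathbf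 A}\frac{\mathsf{UW}(\mathbf A)}{\mathsf{OPT}_U(\mathcal I)}$, the supremum over all fair-chores instances with $n$ agents (any number of items) and the minimum over all MMS fair allocations $\mathbf A$ of $\mathcal I$; conventions: $c/0=+\infty$ for $c<0$ and $0/0=1$. *)

(* Defs.v *)
From mathcomp Require Import all_boot all_order all_algebra.
From mathcomp Require Import classical_sets reals constructive_ereal ereal.

Set Implicit Arguments.
Unset Strict Implicit.
Unset Printing Implicit Defensive.

Import Order.TTheory GRing.Theory Num.Theory.
Local Open Scope ring_scope.

(* The items are the elements of 'I_nitems, placed on a path in their natural
   order; itemval i e is v_i(e) itself (nonpositive), not the cost - v_i(e). *)
Record chores (R : realType) (n : nat) := Chores {
  nitems : nat;
  itemval : 'I_n -> 'I_nitems -> R;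
  itemval_le0 : forall i e, itemval i e <= 0;
  itemval_norm : forall i, \sum_(e < nitems) itemval i e = -1 }.

Section Bundles.
Variables (n m : nat).

Definition contiguous (S : {set 'I_m}) : bool :=
  [forall x in S, forall z in S, forall y : 'I_m,
     ((x <= y)%N && (y <= z)%N) ==> (y \in S)].

(* Bundles may be empty, and their left-to-right order is arbitrary. *)
Definition connected_partition (A : {ffun 'I_n -> {set 'I_m}}) : bool :=
  [&& [forall i, contiguous (A i)],
      [forall i, forall j, (i != j) ==> [disjoint A i & A j]] &
      [forall e, exists i, e \in A i]].

End Bundles.

Section Welfare.
Variables (R : realType) (n : nat) (I : chores R n).

Definition assignment := {ffun 'I_n -> {set 'I_(nitems I)}}.

Definition value (i : 'I_n) (S : {set 'I_(nitems I)}) : R :=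
  \sum_(e in S) itemval i e.

Definition UW (A : assignment) : R := \sum_(i < n) value i (A i).

(* All extrema below range over finite sets; -oo and +oo are only the values of
   an empty maximum and of an empty minimum. *)
Definition OPT_U : \bar R :=
  \big[maxe/-oo%E]_(A : assignment | connected_partition A) (UW A)%:E.

Definition MMS (i : 'I_n) : \bar R :=
  \big[maxe/-oo%E]_(X : assignment | connected_partition X)
    \big[mine/+oo%E]_(j < n) (value i (X j))%:E.

Definition MMS_fair (A : assignment) : bool :=
  connected_partition A && [forall i, (MMS i <= (value i (A i))%:E)%E].

End Welfare.

(* Quotient of nonpositive numbers, with c / 0 = +oo for c < 0 and 0 / 0 = 1. *)
Definition ratio (R : realType) (x y : R) : \bar R :=
  if y == 0 then (if x == 0 then 1%E else +oo%E) else (x / y)%:E.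

Definition price (R : realType) (n : nat) (I : chores R n) : \bar R :=
  \big[mine/+oo%E]_(A : assignment I | MMS_fair A)
    ratio (UW A) (fine (OPT_U I)).

Definition PoF (R : realType) (n : nat) : \bar R :=
  ereal_sup (range (fun I : chores R n => price I)).

(* Main.v *)
Require Import Defs.
From mathcomp Require Import all_boot all_order all_algebra.
From mathcomp Require Import classical_sets reals constructive_ereal ereal.
From mathcomp Require Import zify lra.

Set Implicit Arguments.
Unset Strict Implicit.
Unset Printing Implicit Defensive.

Import Order.TTheory GRing.Theory Num.Theory.
Local Open Scope ring_scope.

(* Write costs for negated values and let T_i be the maximin cost share of agent i.
   Upper bound: some MMS fair allocation has total cost at most 8.  Since an unfair
   optimum costs more than 1/n, this gives PoF_n <= 8n.  The allocation comes from a
   moving knife in which agent i only accepts pieces of cost at most min(T_i, D), where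
   D is the larger of 8/n and the median of the T_i; the longest acceptable piece wins.
   An agent with T_i > D may be blocked by a single item of cost more than D, but any
   other winner then passes this item, so every unserved agent stays ahead of its own
   greedy cuts.  Agents with T_i <= D accept every single item, and need at most n cuts;
   agents with T_i >= D need about 2/D cuts.  If D = 8/n, the n pieces cost at most 8
   altogether.  Otherwise half of the agents have T_i >= D, one of them is still
   unserved after about 2/D pieces, and at that moment everything is allocated.
   Lower bound: the best allocation gives agent 0, who values n items equally, two items
   that everyone else dislikes at 1/2; fairness moves one of them to another agent. *)

(** * Intervals of consecutive items *)

Definition span (m x y : nat) : {set 'I_m} := [set e : 'I_m | (x <= e < y)%N].

Lemma contiguous_span m x y : contiguous (span m x y).
Proof.
apply/forall_inP=> a; rewrite inE => /andP[xa ay].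
apply/forall_inP=> b; rewrite inE => /andP[xb yb].
by apply/forallP=> e; apply/implyP=> /andP[ae eb]; rewrite inE; lia.
Qed.

Lemma disjoint_span m x y x' y' :
  (y <= x')%N -> [disjoint span m x y & span m x' y'].
Proof.
move=> yx'; rewrite -finset.setI_eq0; apply/eqP/finset.setP=> e; rewrite !inE.
by lia.
Qed.

(** * Greedy cuts of a single agent *)

Section Reach.
Variables (R : realDomainType) (m : nat) (w : 'I_m -> R) (th : R).
Hypothesis w_ge0 : forall e, 0 <= w e.

Lemma ler_sum_subset (S S' : {set 'I_m}) :
  S \subset S' -> \sum_(e in S) w e <= \sum_(e in S') w e.
Proof.
move=> sSS'; rewrite (finset.big_setID S (A := S')) /= (finset.setIidPr sSS') lerDl.
exact: sumr_ge0.
Qed.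

(* The last cut that a bundle starting at [x] can reach at cost at most [th];
   an item of cost more than [th] is passed on its own. *)
Definition reach (x : nat) : nat :=
  \max_(y < m.+1 | (y <= x.+1)%N || (\sum_(e in span m x y) w e <= th)) y.

Lemma reach_le x : (reach x <= m)%N.
Proof. by apply/bigmax_leqP=> y _; rewrite -ltnS. Qed.

Lemma reach_ge x y : (y <= m)%N ->
  (y <= x.+1)%N || (\sum_(e in span m x y) w e <= th) -> (y <= reach x)%N.
Proof.
move=> ym H; have ym1 : (y < m.+1)%N by [].
exact: (leq_bigmax_cond (F := fun i : 'I_m.+1 => i : nat) (Ordinal ym1)).
Qed.

Lemma reachP x :
  (reach x <= x.+1)%N || (\sum_(e in span m x (reach x)) w e <= th).
Proof.
pose A := [pred y : 'I_m.+1 |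
  (y <= x.+1)%N || (\sum_(e in span m x y) w e <= th)].
have A_gt0 : (0 < #|A|)%N.
  by apply/card_gt0P; exists ord0; rewrite inE leq0n.
rewrite /reach.
by have [y + ->] := eq_bigmax_cond (fun y : 'I_m.+1 => y : nat) A_gt0; rewrite inE.
Qed.

Lemma reach_gt x : (x < m)%N -> (x < reach x)%N.
Proof. by move=> xm; apply: reach_ge => //; rewrite leqnn. Qed.

Lemma reach_mono x y : (x <= y)%N -> (reach x <= reach y)%N.
Proof.
move=> xy; apply: reach_ge; first exact: reach_le.
case/orP: (reachP x) => [|H]; first by lia.
apply/orP; right; apply: le_trans H; apply: ler_sum_subset.
by apply/fintype.subsetP=> e; rewrite !inE; lia.
Qed.

Lemma iter_reach_le t : (iter t reach 0 <= m)%N.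
Proof. by case: t => //= t; apply: reach_le. Qed.

(** The single-item exception in [reach] is harmless here: a piece that arises from it contains at
    most the item [e]. *)
Lemma reach_cost (e : 'I_m) : w e <= th ->
  \sum_(f in span m e (reach e)) w f <= th.
Proof.
move=> weth; case/orP: (reachP e) => // H; apply: le_trans weth.
rewrite -(big_set1 +%R e w); apply: ler_sum_subset.
by apply/fintype.subsetP=> f; rewrite !inE -val_eqE /=; lia.
Qed.

(** A blocked agent advances by one item only, so it cannot overtake the winner of a nonempty piece
    starting at [e]. *)
Lemma reach_skip (e : 'I_m) : th < w e -> (reach e <= e.+1)%N.
Proof.
move=> the; case/orP: (reachP e) => // H; rewrite leqNgt; apply/negP => er.
suff H' : w e <= \sum_(f in span m e (reach e)) w f.
  by have := lt_le_trans the (le_trans H' H); rewrite ltxx.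
rewrite -[w e](big_set1 +%R e w); apply: ler_sum_subset.
by apply/fintype.subsetP=> f; rewrite !inE -val_eqE /=; lia.
Qed.

Lemma reach_over x : (reach x < m)%N ->
  th < \sum_(e in span m x (reach x).+1) w e.
Proof.
move=> rm; rewrite ltNge; apply/negP=> H.
by have := reach_ge rm (introT orP (or_intror H)); rewrite ltnn.
Qed.

Lemma iter_reach_stable s t : (s <= t)%N ->
  iter s reach 0%N = m -> iter t reach 0%N = m.
Proof.
move=> /subnK <- sm; elim: (t - s)%N => //= d ->.
by apply/eqP; rewrite eqn_leq reach_le reach_ge // leqnSn.
Qed.

(* Each pair of consecutive greedy bundles accounts for a cost of more than [th]. *)
Lemma iter_reach_over i : (iter i.*2.+1 reach 0 < m)%N ->
  i.+1%:R * th < \sum_(e in span m 0%N (iter i.*2.+1 reach 0%N).+1) w e.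
Proof.
elim: i => [|i IH]; first by rewrite mul1r; apply: reach_over.
rewrite doubleS iterS [iter _.+2 _ _]iterS; set x := iter i.*2.+1 reach 0 => rm.
have xm : (x < m)%N.
  rewrite ltnNge; apply/negP=> mx.
  have e : x = m by have := iter_reach_le i.*2.+1; rewrite -/x; lia.
  have rm' : reach m = m.
    by apply/eqP; rewrite eqn_leq reach_le reach_ge //; lia.
  by move: rm; rewrite e !rm' ltnn.
have xr := reach_gt xm.
(* The overflow item [x] of the first span falls into the skipped bundle from [x] to [reach x],
   which keeps the two costly spans disjoint. *)
have sub : span m 0%N x.+1 :|: span m (reach x) (reach (reach x)).+1 \subset
  span m 0%N (reach (reach x)).+1.
  have := reach_mono (ltnW xr); rewrite finset.subUset => ?.
  by apply/andP; split; apply/fintype.subsetP=> e; rewrite !inE; lia.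
apply: lt_le_trans (ler_sum_subset sub).
have disj : [disjoint span m 0%N x.+1 & span m (reach x) (reach (reach x)).+1].
  exact: disjoint_span.
rewrite (eq_bigl _ _ (fun e => finset.in_setU e _ _)) (bigU _ _ _ disj) /=.
by rewrite -[i.+2]addn1 natrD mulrDl mul1r; apply: ltrD (IH xm) (reach_over rm).
Qed.

Lemma iter_reach_full i : \sum_e w e <= i.+1%:R * th -> iter i.*2.+1 reach 0%N = m.
Proof.
move=> H; apply/eqP; rewrite eqn_leq iter_reach_le leqNgt; apply/negP.
move=> /iter_reach_over; rewrite ltNge; apply/negP; rewrite negbK.
apply: le_trans H; apply: le_trans (ler_sum_subset (finset.subsetT _)) _.
by rewrite (eq_bigl xpredT) // => e; rewrite inE.
Qed.

(** Count the bundles of [X] that meet the items from the current cut on. The bundle holding the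
    item at the cut is an interval of cost at most [th], so the next cut passes all of it and the
    count drops. After [n] cuts no bundle is left to hold a further item. *)
Lemma iter_reach_partition n (X : {ffun 'I_n -> {set 'I_m}}) :
    connected_partition X -> (forall j, \sum_(e in X j) w e <= th) ->
  iter n reach 0%N = m.
Proof.
case/and3P=> /forallP cX _ /forallP cover Xth.
pose meets x := [set j | [exists e in X j, (x <= e)%N]].
have meetsS x : (x < m)%N -> (#|meets (reach x)| < #|meets x|)%N.
  move=> xm; apply: proper_card; apply/properP; split.
    apply/fintype.subsetP=> j; rewrite !inE => /exists_inP[e eX re].
    by apply/exists_inP; exists e => //; have := reach_gt xm; lia.
  have /existsP[j xj] := cover (Ordinal xm); exists j; rewrite !inE.
    by apply/exists_inP; exists (Ordinal xm).
  apply/negP=> /exists_inP[e eX re].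
  suff : (e.+1 <= reach x)%N by lia.
  apply: reach_ge => //; apply/orP; right; apply: le_trans (Xth j).
  apply: ler_sum_subset; apply/fintype.subsetP=> f; rewrite inE => /andP[xf fe].
  move/forall_inP: (cX j) => /(_ _ xj) /forall_inP/(_ _ eX)/forallP/(_ f)/implyP.
  by apply=> /=; rewrite xf -ltnS.
have H t : (iter t reach 0 < m)%N -> (#|meets (iter t reach 0%N)| + t <= n)%N.
  elim: t => [_|t IH lt]; first by rewrite addn0 -[leqRHS]card_ord max_card.
  have xm : (iter t reach 0 < m)%N.
    rewrite ltnNge; apply/negP=> mx; have := reach_mono mx.
    by have := @reach_ge m m (leqnn m); rewrite leqnSn => /(_ isT); move: lt => /=; lia.
  by have := IH xm; have := meetsS _ xm; move: lt => /=; lia.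
apply/eqP; rewrite eqn_leq iter_reach_le leqNgt; apply/negP=> lt.
have := H n lt; suff : (0 < #|meets (iter n reach 0%N)|)%N by lia.
have /existsP[j xj] := cover (Ordinal lt); apply/card_gt0P; exists j.
by rewrite inE; apply/exists_inP; exists (Ordinal lt).
Qed.

End Reach.

(** * The moving knife with a threshold for each agent *)

Section MovingKnife.
Variables (R : realDomainType) (n m : nat) (c : 'I_n -> 'I_m -> R) (th : 'I_n -> R).
Hypothesis c_ge0 : forall i e, 0 <= c i e.
Hypothesis th_ge0 : forall i, 0 <= th i.

Let cut (t : nat) (k : 'I_n) : nat := iter t (reach (c k) (th k)) 0%N.

(** The state of the procedure when the knife stands at [x] and the agents of [U] have been
    served. *)
Definition prefix_allocation (U : {set 'I_n}) (x : nat)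
    (A : {ffun 'I_n -> {set 'I_m}}) : Prop :=
  [/\ forall i, contiguous (A i),
      forall i j, i != j -> [disjoint A i & A j],
      forall e : 'I_m, [exists i, e \in A i] = (e < x)%N,
      forall i, \sum_(e in A i) c i e <= th i &
      forall i, i \notin U -> A i = finset.set0].

Lemma prefix_allocation0 : prefix_allocation finset.set0 0%N [ffun=> finset.set0].
Proof.
split=> [i|i j _|e|i|i _]; rewrite ?ffunE //.
- by apply/forall_inP=> a; rewrite inE.
- by rewrite -finset.setI_eq0 finset.set0I.
- by apply/existsP=> -[i]; rewrite ffunE inE.
- by rewrite big_set0.
Qed.

(** Acceptance of the item at the knife is what keeps the whole piece of [k] within [th k], by
    [reach_cost]. *)
Lemma prefix_allocation_step U (x : 'I_m) A k :
    prefix_allocation U x A -> k \notin U -> c k x <= th k ->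
  exists A', prefix_allocation (k |: U) (reach (c k) (th k) x) A'.
Proof.
move=> [ctg disj cover cost_le outside] kU kx.
have xr : (x < reach (c k) (th k) x)%N by exact: reach_gt.
exists [ffun i => if i == k then span m x (reach (c k) (th k) x) else A i].
have disj_span i : [disjoint A i & span m x (reach (c k) (th k) x)].
  rewrite -finset.setI_eq0; apply/eqP/finset.setP=> e; rewrite !inE.
  apply/negP=> /andP[eA]; have := cover e.
  have -> : [exists i, e \in A i] by apply/existsP; exists i.
  by lia.
split=> [i|i j ij|e|i|i].
- by rewrite ffunE; case: eqP => // _; apply: contiguous_span.
- rewrite !ffunE; case: ifP => [/eqP ik|_]; case: ifP => [/eqP jk|_] //.
  + by rewrite ik jk eqxx in ij.
  + by rewrite disjoint_sym.
  + exact: disj.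
- apply/existsP/idP => [[i]|er].
    rewrite ffunE; case: ifP => _ eA; first by move: eA; rewrite inE => /andP[].
    have := cover e; have -> : [exists i, e \in A i] by apply/existsP; exists i.
    by lia.
  case: (leqP x e) => [xe|ex].
    by exists k; rewrite ffunE eqxx inE xe.
  have := cover e; rewrite ex => /existsP[i eA]; exists i; rewrite ffunE.
  by case: eqP => // ik; move: eA; rewrite ik outside // inE.
- by rewrite ffunE; case: eqP => [->|_] //; apply: reach_cost.
- rewrite !inE negb_or ffunE => /andP[/negPf-> iU]; exact: outside.
Qed.

(* Giving each piece to the bidder that reaches furthest keeps every agent still
   without a piece ahead of its own greedy cuts. *)
Lemma moving_knife (tau : nat) : (0 < n)%N ->
    (forall (U : {set 'I_n}) (x : nat), (x < m)%N -> (#|U| < tau)%N ->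
       (forall k, k \notin U -> (cut #|U| k <= x)%N) ->
       exists2 b, b \notin U & forall e, c b e <= th b) ->
  exists (U : {set 'I_n}) A x, [/\ prefix_allocation U x A, (#|U| <= tau)%N, (x <= m)%N &
    x = m \/ [/\ #|U| = tau, forall k, k \notin U -> (cut tau k <= x)%N
                & exists k, (cut tau k <= x)%N]].
Proof.
move=> n_gt0; elim: tau => [|tau IH] bidder.
  exists finset.set0, [ffun=> finset.set0], 0%N; rewrite finset.cards0.
  split=> //; first exact: prefix_allocation0.
  by right; split=> //; exists (Ordinal n_gt0).
have [|U [A [x [pA Utau xm]]]] := IH.
  by move=> U x xm Ut; apply: bidder => //; apply: ltnW.
case: (ltnP x m) => [{}xm|mx]; last first.
  by exists U, A, x; split=> //; [exact: leqW | left; lia].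
case=> [|[Ut ahead _]]; first by lia.
have [||b bU b_bids] := bidder U x xm; rewrite ?Ut //.
pose e := Ordinal xm; pose r k := reach (c k) (th k) x.
pose bids k := (k \notin U) && (c k e <= th k).
have bids_b : bids b by rewrite /bids bU b_bids.
case: (@arg_maxnP _ b bids r bids_b) => k /andP[kU ke] kmax.
have [A' pA'] := @prefix_allocation_step U e A k pA kU ke.
have cutS j : j \notin U -> (cut tau.+1 j <= r k)%N.
  move=> jU; apply: (@leq_trans (r j)); first exact/reach_mono/ahead.
  case: (leP (c j e) (th j)) => je; first by apply: kmax; rewrite /bids jU.
  by apply: leq_trans (reach_skip _ je) _ => //; apply: reach_gt.
exists (k |: U), A', (r k); split=> //.
- by rewrite cardsU1 kU Ut.
- exact: reach_le.
- right; split; first by rewrite cardsU1 kU Ut.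
    by move=> j; rewrite !inE negb_or => /andP[_]; apply: cutS.
  (* The winner was unserved before this piece, so it is ahead of its cuts too. It is the witness
     when every agent has been served. *)
  by exists k; apply: cutS.
Qed.

Lemma prefix_allocation_full U A :
  prefix_allocation U m A -> connected_partition A.
Proof.
case=> ctg disj cover _ _; apply/and3P; split; first exact/forallP.
  by apply/forallP=> i; apply/forallP=> j; apply/implyP/disj.
by apply/forallP=> e; rewrite cover.
Qed.

End MovingKnife.

Lemma exists_notin (T : finType) (A B : {set T}) :
  (#|B| < #|A|)%N -> exists2 x, x \in A & x \notin B.
Proof.
move=> BA; have : ~~ (A \subset B) by apply: contraTN BA => /subset_leq_card; lia.
by case/subsetPn=> x; exists x.
Qed.

(** * Fair allocations of total cost at most 8 *)

Section FairAllocation.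
Variables (R : archiRealFieldType) (n m : nat) (c : 'I_n -> 'I_m -> R) (T : 'I_n -> R).
Hypothesis n_gt0 : (0 < n)%N.
Hypothesis c_ge0 : forall i e, 0 <= c i e.
Hypothesis c_total : forall i, \sum_e c i e = 1.
Hypothesis T_share : forall i, exists2 X : {ffun 'I_n -> {set 'I_m}},
  connected_partition X & forall j, \sum_(e in X j) c i e <= T i.

Lemma share_ge0 i : 0 <= T i.
Proof.
by have [X _ /(_ (Ordinal n_gt0)) +] := T_share i; apply: le_trans; apply: sumr_ge0.
Qed.

Lemma item_le_share i e : c i e <= T i.
Proof.
have [X /and3P[_ _ /forallP/(_ e)/existsP[j ej]] XT] := T_share i.
by apply: le_trans (XT j); rewrite (bigD1 e) //= lerDl sumr_ge0.
Qed.

(** Agents with [D <= T i] finish within [d.*2.+1] cuts. Up to that many pieces, some unserved agent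
    has [T i <= D] and accepts every item. Later, an unserved agent with a larger share would have
    its cuts at [m], hence the knife too. The knife has reached [m] after [tau] pieces: by the [n]
    cuts of the last winner if [tau = n], and otherwise because an agent with [D <= T i] is still
    unserved. *)
Lemma fair_allocation_at_level (D : R) (d tau : nat) :
    0 <= D -> 1 <= d.+1%:R * D ->
    (d.*2.+1 <= #|[set i | (T i <= D)%R]|)%N ->
    (tau = n \/ tau = d.*2.+1 /\ (tau < #|[set i | (D <= T i)%R]|)%N) ->
  exists2 A : {ffun 'I_n -> {set 'I_m}}, connected_partition A &
    (forall i, \sum_(e in A i) c i e <= T i) /\
    \sum_i \sum_(e in A i) c i e <= tau%:R * D.
Proof.
(* The cap [T i] makes each piece fair, and the cap [D] bounds the total cost. *)
move=> D_ge0 dD few_low tau_def; pose th i := Num.min (T i) D.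
have th_ge0 i : 0 <= th i by rewrite le_min share_ge0.
have cut_high i : D <= T i -> iter d.*2.+1 (reach (c i) (th i)) 0%N = m.
  by move=> Di; apply: iter_reach_full => //; rewrite c_total /th min_r.
have cut_low i : T i <= D -> iter n (reach (c i) (th i)) 0%N = m.
  move=> iD; have [X pX XT] := T_share i.
  by apply: (iter_reach_partition _ pX) => // j; rewrite /th min_l.
have low_le_n : (#|[set i | (T i <= D)%R]| <= n)%N by rewrite -[leqRHS]card_ord max_card.
have [|U [A [x [pA Utau xm end_]]]] := moving_knife c_ge0 th_ge0 (tau := tau) n_gt0.
  move=> U x xm Ut ahead; case: (ltnP #|U| d.*2.+1) => Ud.
    have [b] := exists_notin (leq_trans Ud few_low); rewrite inE => bD bU.
    by exists b => // e; rewrite /th min_l // item_le_share.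
  case: tau_def => [tau_n|[tau_d _]]; last by lia.
  have [k _ kU] : exists2 k, k \in [set: 'I_n] & k \notin U.
    by apply: exists_notin; rewrite cardsT card_ord; lia.
  exists k => // e; case: (leP (T k) D) => kD; first by rewrite /th min_l // item_le_share.
  by have := ahead k kU; rewrite (iter_reach_stable Ud (cut_high k (ltW kD))); lia.
have {}xm : x = m.
  case: end_ => // -[Ut ahead [k kx]]; case: tau_def => [tau_n|[tau_d few_high]].
    rewrite tau_n in kx; case: (leP (T k) D) => kD; move: kx.
      by rewrite cut_low //; lia.
    by rewrite (iter_reach_stable _ (cut_high k (ltW kD))); lia.
  rewrite -[X in (X < _)%N]Ut in few_high.
  have [j] := exists_notin few_high; rewrite inE => Dj /ahead.
  by rewrite tau_d cut_high //; lia.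
rewrite xm in pA; exists A; first exact: (prefix_allocation_full pA).
case: pA => _ _ _ cost_le outside; split=> [i|].
  by apply: le_trans (cost_le i) _; rewrite ge_min lexx.
rewrite (bigID (mem U)) /= [X in _ + X]big1 => [|i /outside->]; last by rewrite big_set0.
rewrite addr0; apply: (@le_trans _ _ (\sum_(i in U) D)).
  by apply: ler_sum => i _; apply: le_trans (cost_le i) _; rewrite ge_min lexx orbT.
by rewrite sumr_const -[leLHS]mulr_natl ler_wpM2r // ler_nat.
Qed.

Lemma cheap_fair_allocation : (1 < n)%N -> (forall i, T i <= 1) ->
  exists2 A : {ffun 'I_n -> {set 'I_m}}, connected_partition A &
    (forall i, \sum_(e in A i) c i e <= T i) /\
    \sum_i \sum_(e in A i) c i e <= 8.
Proof.
move=> n_gt1 T_le1; have n_pos : (0 : R) < n%:R by rewrite ltr0n.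
pose low (D : R) := [set i | T i <= D].
case: (leqP n (#|low (8 / n%:R)%R|).*2) => many_low.
  (* The least [d] with [d.+1 * (8 / n) >= 1]; then [d.*2.+1] is at most half of [n], rounded up. *)
  pose d := (n.-1 %/ 8)%N.
  have [|||A pA [A_fair A_cost]] :=
      @fair_allocation_at_level (8 / n%:R) d n _ _ _ (or_introl erefl).
  - by rewrite divr_ge0.
  - rewrite mulrA ler_pdivlMr // mul1r -natrM ler_nat /d; lia.
  - by rewrite -/(low _) /d; lia.
  by exists A => //; split=> //; move: A_cost; rewrite mulrCA divff ?mulr1 // gt_eqF.
(* The largest share has all agents below or at it, so there is a least share [D] with at least half
   of the agents at or below it. *)
have [k0 k0_med] : exists k, (n <= (#|low (T k)|).*2)%N.
  have [k _ kmax] := @arg_maxP _ _ _ (Ordinal n_gt0) xpredT T isT.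
  exists k; rewrite [low _](_ : _ = finset.setT) ?cardsT ?card_ord; first by lia.
  by apply/finset.setP=> i; rewrite !inE; apply: kmax.
have [k k_med kmin] := @arg_minP _ _ _ k0 (fun k => n <= (#|low (T k)|).*2)%N T k0_med.
set D := T k in k_med kmin.
(* If half of the agents were strictly below [D], the largest share among them would contradict the
   minimality of [D]. *)
have many_high : (n < (#|[set i | (D <= T i)%R]|).*2)%N.
  pose below := [set i | (T i < D)%R].
  have card_high : (#|[set i | (D <= T i)%R]| + #|below| = n)%N.
    rewrite addnC -[RHS]card_ord -(cardC [in below]); congr (_ + _)%N.
    by apply: eq_card => i; rewrite !inE -leNgt.
  suff : ((#|below|).*2 < n)%N by lia.
  rewrite ltnNge; apply/negP => below_half.
  have /card_gt0P[j0 j0_below] : (0 < #|below|)%N by lia.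
  have [j j_below jmax] := @arg_maxP _ _ _ j0 [in below] T j0_below.
  have sub : below \subset low (T j).
    by apply/fintype.subsetP=> i i_below; rewrite inE; apply: jmax.
  have := kmin j (leq_trans below_half _); rewrite leq_double subset_leq_card //.
  by move=> /(_ isT); move: j_below; rewrite inE ltNge => /negP.
have D_gt : 8 / n%:R < D.
  rewrite ltNge; apply: contraTN many_low => Dn; rewrite -leqNgt; apply: leq_trans k_med _.
  rewrite leq_double subset_leq_card //; apply/fintype.subsetP=> i; rewrite !inE.
  by move/le_trans; apply.
have D_gt0 : 0 < D by apply: le_lt_trans D_gt; rewrite divr_ge0.
pose d := Num.truncn D^-1.
have /andP[dD Dd] : d%:R <= D^-1 < d.+1%:R by apply: truncn_itv; rewrite invr_ge0 ltW.
have dD1 : d%:R * D <= 1 by rewrite -ler_pdivlMr // mul1r.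
have d_lt : (8 * d < n)%N.
  rewrite -(ltr_nat R) natrM -(ltr_pM2r D_gt0).
  by move: D_gt; rewrite ltr_pdivrMr //; lra.
have [||||A pA [A_fair A_cost]] := @fair_allocation_at_level D d d.*2.+1.
- exact: ltW.
- by rewrite -ler_pdivrMr // mul1r ltW.
- by move: k_med; rewrite /low; lia.
- by right; split=> //; lia.
exists A => //; split=> //; apply: le_trans A_cost _.
(* From [d * D <= 1] and [D <= 1] the total [(2 d + 1) D] is even at most 3. *)
have D1 : D <= 1 by exact: T_le1.
by rewrite -addn1 -muln2 natrD natrM; nra.
Qed.

End FairAllocation.

(** * Extrema of a chores instance and the upper bound on its price *)

Section Chores.
Variables (R : realType) (n : nat) (I : chores R n).
Hypothesis n_gt0 : (0 < n)%N.

(** Ensures that [OPT_U] and [MMS] are true maxima and not the default [-oo]; one agent takes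
    everything. *)
Lemma exists_connected_partition : exists A : assignment I, connected_partition A.
Proof.
exists [ffun i => if i == Ordinal n_gt0 then [set: 'I_(nitems I)] else finset.set0].
apply/and3P; split.
- apply/forallP=> i; rewrite ffunE; apply/forall_inP=> a aA; apply/forall_inP=> b _.
  by apply/forallP=> e; apply/implyP=> _; move: aA; case: ifP; rewrite !inE.
- apply/forallP=> i; apply/forallP=> j; apply/implyP; rewrite !ffunE.
  case: ifP => [/eqP->|_] ij; last by rewrite -finset.setI_eq0 finset.set0I.
  by rewrite eq_sym (negPf ij) -finset.setI_eq0 finset.setI0.
- apply/forallP=> e; apply/existsP; exists (Ordinal n_gt0).
  by rewrite ffunE eqxx inE.
Qed.

Lemma OPT_U_attained : exists2 O : assignment I, connected_partition O &
  OPT_U I = (UW O)%:E /\ forall A : assignment I, connected_partition A -> UW A <= UW O.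
Proof.
have [A0 pA0] := exists_connected_partition.
have [O pO OPT_eq] := @eq_bigmax _ _ _ -oo%E A0 _
  (fun A : assignment I => (UW A)%:E) pA0 (fun _ _ => leNye _).
exists O => //; split=> // A pA; rewrite -lee_fin -OPT_eq.
exact: (le_bigmax_cond _ (fun A : assignment I => (UW A)%:E)).
Qed.

Lemma MMS_attained i : exists2 X : assignment I, connected_partition X &
  exists2 j0, MMS I i = (value i (X j0))%:E & forall j, value i (X j0) <= value i (X j).
Proof.
have [A0 pA0] := exists_connected_partition.
have [X pX MMS_eq] := @eq_bigmax _ _ _ -oo%E A0 _
  (fun X : assignment I => \big[mine/+oo%E]_(j < n) (value i (X j))%:E)
  pA0 (fun _ _ => leNye _).
have [j0 _ min_eq] := @eq_bigmin _ _ _ +oo%E (Ordinal n_gt0) xpredT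
  (fun j : 'I_n => (value i (X j))%:E) isT (fun _ _ => leey _).
exists X => //; exists j0; first by rewrite /MMS MMS_eq min_eq.
by move=> j; rewrite -lee_fin -min_eq; apply: bigmin_le.
Qed.

Lemma value_le0 i S : value (I := I) i S <= 0.
Proof. by apply: sumr_le0 => e _; apply: itemval_le0. Qed.

Lemma UW_le0 (A : assignment I) : UW A <= 0.
Proof. by apply: sumr_le0 => i _; apply: value_le0. Qed.

Lemma value_total i (X : assignment I) :
  connected_partition X -> \sum_j value i (X j) = -1.
Proof.
case/and3P=> _ /forallP disj /forallP cover; rewrite -(itemval_norm I i).
rewrite /value (exchange_big_dep xpredT) //=; apply: eq_bigr => e _.
have /existsP[j ej] := cover e; rewrite (big_pred1 j) // => k.
apply/idP/eqP => [ek|->//]; apply/eqP; apply/negPn/negP => kj.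
have /forallP/(_ j)/implyP/(_ kj) := disj k.
by move/pred0P/(_ e); rewrite /= ek ej.
Qed.

(** The [n] bundles of a partition are worth -1 together and each at most 0, so the worst of them
    lies between -1 and [- n%:R^-1]. *)
Lemma MMS_bounds i : exists2 T : R, MMS I i = (- T)%:E &
  [/\ n%:R^-1 <= T, T <= 1 & exists2 X : assignment I, connected_partition X &
    forall j, \sum_(e in X j) (- itemval i e) <= T].
Proof.
have [X pX [j0 MMS_eq j0_min]] := MMS_attained i.
exists (- value i (X j0)); first by rewrite opprK.
split.
- have : \sum_(j < n) value i (X j0) <= -1 by rewrite -(value_total i pX) ler_sum.
  rewrite sumr_const card_ord -mulr_natl.
  have n_pos : (0 : R) < n%:R by rewrite ltr0n.
  by move=> le_total; rewrite -[_^-1]div1r ler_pdivrMr //; lra.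
- rewrite lerNl -(value_total i pX) (bigD1 j0) //= gerDl.
  by apply: sumr_le0 => j _; apply: value_le0.
- by exists X => // j; rewrite sumrN lerN2; apply: j0_min.
Qed.

Hypothesis n_gt1 : (1 < n)%N.

Lemma MMS_fair_cheap : exists2 A : assignment I, MMS_fair A & -8 <= UW A.
Proof.
pose T i := - fine (MMS I i).
have TP i : MMS I i = (- T i)%:E /\ [/\ n%:R^-1 <= T i, T i <= 1 &
    exists2 X : assignment I, connected_partition X &
      forall j, \sum_(e in X j) (- itemval i e) <= T i].
  by have [t MMS_eq tP] := MMS_bounds i; rewrite /T MMS_eq /= !opprK.
have [|||i|A pA [A_fair A_cost]] := @cheap_fair_allocation R n (nitems I)
    (fun i e => - itemval i e) T n_gt0 _ _ _ n_gt1.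
- by move=> i e; rewrite oppr_ge0 itemval_le0.
- by move=> i; rewrite sumrN itemval_norm opprK.
- by move=> i; case: (TP i) => _ [].
- by case: (TP i) => _ [].
exists A.
  rewrite /MMS_fair pA; apply/forallP=> i; rewrite (TP i).1 lee_fin lerNl.
  by have := A_fair i; rewrite sumrN.
rewrite lerNl; apply: le_trans A_cost; rewrite -sumrN le_eqVlt; apply/orP; left.
by apply/eqP/eq_bigr=> i _; rewrite sumrN.
Qed.

Lemma price_le : (price I <= (8 * n%:R)%:E)%E.
Proof.
have n_pos : (0 : R) < n%:R by rewrite ltr0n.
have n_ge2 : (2 : R) <= n%:R by rewrite ler_nat.
have [O pO [OPT_eq OPT_max]] := OPT_U_attained.
(* A fair optimum has ratio 1, also by the convention for 0 / 0. An unfair one gives some agent less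
   than its share, which is at most [- n%:R^-1]. *)
have [O_fair|O_unfair] := boolP (MMS_fair O).
  apply: le_trans (bigmin_le_cond _ _ O_fair) _; rewrite OPT_eq /Defs.ratio /=.
  by case: eqVneq => [_|UW_neq0]; rewrite ?divff // lee_fin; lra.
have {}O_unfair : UW O < - n%:R^-1.
  move: O_unfair; rewrite /MMS_fair pO /= negb_forall => /existsP[i].
  have [T -> [nT _ _]] := MMS_bounds i; rewrite lee_fin -ltNge => /lt_le_trans.
  move/(_ _ (lexx _)) => Oi; have : UW O <= value i (O i).
    by rewrite /UW (bigD1 i) //= gerDl; apply: sumr_le0 => j _; apply: value_le0.
  by lra.
have [A A_fair UW_A] := MMS_fair_cheap.
apply: le_trans (bigmin_le_cond _ _ A_fair) _; rewrite OPT_eq /Defs.ratio /=.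
have n_inv : 0 < n%:R^-1 :> R by rewrite invr_gt0.
have UW_lt0 : UW O < 0 by lra.
rewrite lt_eqF // lee_fin ler_ndivrMr //.
have : n%:R * UW O <= -1.
  by rewrite -(ler_pdivlMl) // mulrN mulr1 ltW.
by lra.
Qed.

End Chores.

(** * Instances with price at least a quarter of the number of agents *)

Section LowerBound.
Variables (R : realType) (n : nat).
Let N : R := n.+2%:R.

Definition first_pair_val (i e : 'I_n.+2) : R :=
  if i == ord0 then - N^-1 else if (e < 2)%N then - 2^-1 else 0.

Lemma first_pair_val_le0 i e : first_pair_val i e <= 0.
Proof.
by rewrite /first_pair_val; do 2?case: ifP => _ //; rewrite oppr_le0 invr_ge0 ?ler0n.
Qed.

Lemma first_pair_val_norm i : \sum_(e < n.+2) first_pair_val i e = -1.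
Proof.
rewrite /first_pair_val; case: eqP => _.
  by rewrite sumr_const card_ord -mulr_natl mulrN divff // pnatr_eq0.
rewrite !big_ord_recl big1 /= => [|e _]; first by lra.
by rewrite /bump.
Qed.

(* Agent [0] would take both of the items that the others mind, but fairness allows
   it only one. *)
Definition first_pair : chores R n.+2 :=
  Chores first_pair_val_le0 first_pair_val_norm.

Lemma first_pair_MMS0 : ((- N^-1)%:E <= MMS first_pair ord0)%E.
Proof.
(* There are as many items as agents, so each bundle can be a single item of cost [N^-1] to agent
   [0]. *)
pose X : assignment first_pair := [ffun j => finset.set1 j].
have pX : connected_partition X.
  apply/and3P; split.
  - apply/forallP=> j; apply/forall_inP=> a; rewrite ffunE inE => /eqP->.
    apply/forall_inP=> b; rewrite inE => /eqP->.
    by apply/forallP=> e; apply/implyP; rewrite inE andbC -eqn_leq.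
  - apply/forallP=> i; apply/forallP=> j; apply/implyP; rewrite !ffunE => ij.
    by rewrite disjoints1 inE.
  - by apply/forallP=> e; apply/existsP; exists e; rewrite ffunE inE.
apply: (bigmax_sup X) => //; apply: le_bigmin => [|j _]; first exact: leey.
by rewrite lee_fin /value ffunE big_set1.
Qed.

(** Agent [0] takes the first two items, and the next agent takes all the others at no cost. *)
Lemma first_pair_OPT : ((- (2 / N))%:E <= OPT_U first_pair)%E.
Proof.
pose A : assignment first_pair :=
  [ffun j : 'I_n.+2 => if j == ord0 then span n.+2 0%N 2%N
             else if j == lift ord0 ord0 then span n.+2 2%N n.+2 else finset.set0].
have pA : connected_partition A.
  apply/and3P; split.
  - apply/forallP=> j; rewrite ffunE; do 2?case: ifP => _; try exact: contiguous_span.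
    by apply/forall_inP=> a; rewrite inE.
  - apply/forallP=> i; apply/forallP=> j; apply/implyP; rewrite !ffunE => ij.
    case: (i =P ord0) => [i0|_]; case: (j =P ord0) => [j0|_]; try by rewrite i0 j0 eqxx in ij.
    + case: ifP => _; first exact: disjoint_span.
      by rewrite -finset.setI_eq0 finset.setI0.
    + rewrite disjoint_sym; case: ifP => _; first exact: disjoint_span.
      by rewrite -finset.setI_eq0 finset.setI0.
    case: (i =P _) => [i1|_]; last by rewrite -finset.setI_eq0 finset.set0I.
    case: (j =P _) => [j1|_]; last by rewrite -finset.setI_eq0 finset.setI0.
    by rewrite i1 j1 eqxx in ij.
  - apply/forallP=> e; apply/existsP; case: (ltnP e 2) => e2.
      by exists ord0; rewrite ffunE inE e2.
    by exists (lift ord0 ord0); rewrite ffunE inE e2 ltn_ord.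
apply: (bigmax_sup A) => //; rewrite lee_fin /UW big_ord_recl /value.
rewrite [X in _ <= _ + X]big1 ?addr0 => [|j _]; last first.
  rewrite ffunE /=; case: ifP => _; last by rewrite big_set0.
  by apply: big1 => e; rewrite inE /= /first_pair_val /= => /andP[e2 _]; rewrite ltnNge e2.
rewrite ffunE /= (eq_bigr (fun=> - N^-1)) // sumr_const -[leRHS]mulr_natl mulrN lerN2.
rewrite ler_wpM2r ?invr_ge0 ?ler0n // (ler_nat _ _ 2).
rewrite -(size_iota 0 2) cardE -(size_map val); apply: uniq_leq_size.
  by rewrite (map_inj_uniq val_inj) enum_uniq.
by move=> x /mapP[e]; rewrite mem_enum inE mem_iota => /andP[_ e2] ->.
Qed.

(** Both items together would cost agent [0] twice the bound [N^-1] on its share, so another agent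
    holds one of them at cost 1/2. *)
Lemma first_pair_UW A : MMS_fair A -> UW (I := first_pair) A <= - 2^-1.
Proof.
case/andP=> /and3P[_ _ /forallP cover] /forallP/(_ ord0) fair.
have {}fair : - N^-1 <= value ord0 (A ord0).
  by rewrite -lee_fin; apply: le_trans first_pair_MMS0 fair.
have N_pos : 0 < N by rewrite ltr0n.
pose e0 : 'I_n.+2 := ord0; pose e1 : 'I_n.+2 := lift ord0 ord0.
have [e e2 eA] : exists2 e : 'I_n.+2, (e < 2)%N & e \notin A ord0.
  have [e0A|] := boolP (e0 \in A ord0); last by exists e0.
  have [e1A|] := boolP (e1 \in A ord0); last by exists e1.
  suff : value ord0 (A ord0) <= - (2 / N).
    move=> /(le_trans fair); rewrite lerN2 ger_pMl ?invr_gt0 //.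
    by move=> ?; exfalso; lra.
  rewrite /value (bigD1 e0) //= (bigD1 e1) ?e1A //= /first_pair_val /=.
  rewrite [2 / N]mulr_natl mulr2n opprD addrA gerDl.
  by apply: sumr_le0 => e _; rewrite oppr_le0 invr_ge0 ltW.
have /existsP[i ei] := cover e.
have i0 : i != ord0 by apply: contraNneq eA => <-.
rewrite /UW (bigD1 i) //= -[leRHS]addr0 lerD //; last first.
  by apply: sumr_le0 => j _; apply: value_le0.
rewrite /value (bigD1 e) //= [first_pair_val i e]/first_pair_val (negPf i0) e2 gerDl.
by apply: sumr_le0 => f _; apply: first_pair_val_le0.
Qed.

Lemma first_pair_price : ((4^-1 * N)%:E <= price first_pair)%E.
Proof.
apply: le_bigmin => [|A A_fair]; first exact: leey.
have N_pos : 0 < N by rewrite ltr0n.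
have [O pO [OPT_eq _]] := OPT_U_attained first_pair (ltn0Sn n.+1).
have := first_pair_OPT; rewrite OPT_eq lee_fin /Defs.ratio /= => OPT_ge.
have UW_A := first_pair_UW A_fair.
(* A zero optimum would make the ratio [+oo], since fair allocations have negative welfare;
   otherwise it is at least [2^-1 / (2 / N)]. *)
case: eqP => [_|/eqP UW_neq0].
  by rewrite lt_eqF ?leey //; apply: le_lt_trans UW_A _; lra.
have UW_lt0 : UW O < 0 by rewrite lt_neqAle UW_neq0 UW_le0.
rewrite lee_fin ler_ndivlMr //.
have : -2 <= N * UW O by rewrite -ler_pdivrMl // mulrN mulrC.
lra.
Qed.

End LowerBound.

Theorem theorem19 (R : realType) :
  exists c C : R,
    [/\ 0 < c,
        0 < C &
        forall n : nat, (2 <= n)%N ->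
          ((c * n%:R)%:E <= PoF R n)%E /\ (PoF R n <= (C * n%:R)%:E)%E].
Proof.
exists 4^-1, 8; split=> [||[|[|n]] // _]; rewrite ?invr_gt0 //.
split.
  apply: le_trans (first_pair_price R n) _.
  by apply: ereal_sup_ubound; exists (first_pair R n).
by apply: ge_ereal_sup => _ [I _ <-]; apply: price_le.
Qed.
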